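(* Let $\mathcal{C}$ be a category with local products. The following conditions are equivalent: (1) the forgetful functor $\mathbf{Grpd}(\mathcal{C})\to\mathbf{RG}(\mathcal{C})$ is an isomorphism of categories; (2) the forgetful functor $\mathbf{Grpd}(\mathcal{C})\to\mathbf{RG}(\mathcal{C})$ has a section; (3) the forgetful functor $\mathbf{Cat}(\mathcal{C})\to\mathbf{RG}(\mathcal{C})$ is an isomorphism of categories; (4) the forgetful functor $\mathbf{Cat}(\mathcal{C})\to\mathbf{RG}(\mathcal{C})$ has a section; (5) the Kite Condition holds in $\mathcal{C}$. Moreover, when $\mathcal{C}$ has binary products and a terminal object, these conditions are further equivalent to the existence of a natural transformation with components $p_D\colon D\times D\times D\to D$, for $D$ ranging over the objects of $\mathcal{C}$, such that for every object $D$ and every two morphisms $x,y\colon Z\to D$, $$p_D\langle x,y,y\rangle=x,\qquad p_D\langle x,x,y\rangle=y.$$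
   Context: **Local products.** A category $\mathcal{C}$ has local products if for all morphisms $f\colon A\to B$, $r\colon B\to A$, $g\colon C\to B$, $s\colon B\to C$ with $fr=1_B=gs$, the pullback of $g$ along $f$ exists; it comes with a chosen (canonical) pullback $(A\times_B C,\pi_1,\pi_2)$ (so $f\pi_1=g\pi_2$), and the induced morphisms $e_1=\langle 1_A,sf\rangle$, $e_2=\langle rg,1_C\rangle$. **Internal structures.** $\mathbf{RG}(\mathcal{C})$ is the category of reflexive graphs in $\mathcal{C}$: objects are $(C_1,C_0,d,e,c)$ with $d,c\colon C_1\to C_0$, $e\colon C_0\to C_1$, $de=1_{C_0}=ce$; morphisms to $(C_1',C_0',d',e',c')$ are pairs $f_1\colon C_1\to C_1'$, $f_0\colon C_0\to C_0'$ with $d'f_1=f_0d$, $c'f_1=f_0c$, $f_1e=e'f_0$. For a reflexive graph let $(C_2,\pi_1,\pi_2)$ be the (chosen) pullback with $d\pi_1=c\pi_2$, and $e_1=\langle 1_{C_1},ed\rangle$, $e_2=\langle ec,1_{C_1}\rangle\colon C_1\to C_2$. A unital multiplicative graph is a reflexive graph with a morphism $m\colon C_2\to C_1$ such that $dm=d\pi_2$, $cm=c\pi_1$, $me_1=1_{C_1}=me_2$; morphisms are morphisms of reflexive graphs with $f_1m=m'(f_1\times_{f_0}f_1)$. An internal category is a unital multiplicative graph with associative $m$: $m\langle m\langle x,y\rangle,z\rangle=m\langle x,m\langle y,z\rangle\rangle$ for all $x,y,z\colon Z\to C_1$ with $dx=cy$, $dy=cz$. An internal groupoid is an internal category with inverses: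 there is $i\colon C_1\to C_1$ with $di=c$, $ci=d$, $m\langle 1_{C_1},i\rangle=ec$, $m\langle i,1_{C_1}\rangle=ed$. $\mathbf{Cat}(\mathcal{C})$ and $\mathbf{Grpd}(\mathcal{C})$ are the categories of internal categories and internal groupoids (with the morphisms of unital multiplicative graphs). The forgetful functors to $\mathbf{RG}(\mathcal{C})$ forget $m$. A section of a functor $F$ is a functor $S$ with $FS=\mathrm{Id}$. **Kite Condition.** The Kite Condition holds in $\mathcal{C}$ (a category with local products) if for all objects $A,C,E,D,D_0,D_1$ and morphisms $p_1\colon E\to A$, $e_1\colon A\to E$, $p_2\colon E\to C$, $e_2\colon C\to E$, $\alpha\colon A\to D$, $\beta\colon E\to D$, $\gamma\colon C\to D$, and $d$, $c$ with domain $D$ and codomains $D_0$ and $D_1$ respectively, such that - $p_1e_1=1_A$, $p_2e_2=1_C$; - $(e_1p_1)(e_2p_2)=(e_2p_2)(e_1p_1)$; - $(p_1,p_2)$ is jointly monic; - $\alpha p_1e_2p_2=\beta=\gamma p_2e_1p_1$; - $d\alpha p_1=d\alpha p_1e_2p_2$ and $c\gamma p_2=c\gamma p_2e_1p_1$; - $d$ and $c$ have kernel pairs; there exists a unique morphism $m\colon E\to D$ with $me_1=\alpha$, $me_2=\gamma$, $dm=d\gamma p_2$, $cm=c\alpha p_1$. *)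

(* Defs.v *)
From Stdlib Require Import ProofIrrelevance.

Set Implicit Arguments.
Unset Strict Implicit.
Unset Printing Implicit Defensive.

Record Category := {
  Obj :> Type;
  Hom : Obj -> Obj -> Type;
  idm : forall A, Hom A A;
  comp : forall A B D, Hom B D -> Hom A B -> Hom A D;
  comp_idl : forall A B (f : Hom A B), comp (idm B) f = f;
  comp_idr : forall A B (f : Hom A B), comp f (idm A) = f;
  comp_assoc : forall A B D E (h : Hom D E) (g : Hom B D) (f : Hom A B),
    comp h (comp g f) = comp (comp h g) f
}.

Arguments Hom {c} _ _.
Arguments idm {c} _.
Arguments comp {c A B D} _ _.

Declare Scope cat_scope.
Delimit Scope cat_scope with cat.
Local Open Scope cat_scope.

Notation "g ∘ f" := (comp g f) (at level 40, left associativity) : cat_scope.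

Record Functor (X Y : Category) := {
  fobj :> X -> Y;
  fmap : forall A B : X, Hom A B -> Hom (fobj A) (fobj B);
  fmap_id : forall A : X, fmap (idm A) = idm (fobj A);
  fmap_comp : forall (A B D : X) (g : Hom B D) (f : Hom A B),
    fmap (g ∘ f) = fmap g ∘ fmap f
}.

Arguments fmap {X Y} f {A B} _ : rename.

Definition idF (X : Category) : Functor X X :=
  {| fobj := fun A => A;
     fmap := fun A B f => f;
     fmap_id := fun A => eq_refl;
     fmap_comp := fun A B D g f => eq_refl |}.

Lemma compF_id (X Y Z : Category) (G : Functor Y Z) (F : Functor X Y) (A : X) :
  fmap G (fmap F (idm A)) = idm (G (F A)).
Proof. now rewrite !fmap_id. Qed.

Lemma compF_comp (X Y Z : Category) (G : Functor Y Z) (F : Functor X Y)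
    (A B D : X) (g : Hom B D) (f : Hom A B) :
  fmap G (fmap F (g ∘ f)) = fmap G (fmap F g) ∘ fmap G (fmap F f).
Proof. now rewrite !fmap_comp. Qed.

Definition compF (X Y Z : Category) (G : Functor Y Z) (F : Functor X Y) :
    Functor X Z :=
  {| fobj := fun A => G (F A);
     fmap := fun A B f => fmap G (fmap F f);
     fmap_id := compF_id G F;
     fmap_comp := compF_comp G F |}.

(** Equality of functors is strict: equality on objects and on morphisms. *)
Definition IsoOfCategories (X Y : Category) (F : Functor X Y) : Prop :=
  exists G : Functor Y X, compF F G = idF Y /\ compF G F = idF X.

Definition HasSection (X Y : Category) (F : Functor X Y) : Prop :=
  exists S : Functor Y X, compF F S = idF Y.

Record NatTrans (X Y : Category) (F G : Functor X Y) := {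
  component :> forall A : X, Hom (F A) (G A);
  naturality : forall (A B : X) (f : Hom A B),
    fmap G f ∘ component A = component B ∘ fmap F f
}.

Definition FullSub (X : Category) (P : X -> Prop) : Category :=
  {| Obj := {A : X | P A};
     Hom := fun A B => Hom (proj1_sig A) (proj1_sig B);
     idm := fun A => idm (proj1_sig A);
     comp := fun A B D g f => g ∘ f;
     comp_idl := fun A B f => comp_idl f;
     comp_idr := fun A B f => comp_idr f;
     comp_assoc := fun A B D E h g f => comp_assoc h g f |}.

Definition inclusion (X : Category) (P : X -> Prop) : Functor (FullSub P) X :=
  {| fobj := fun A : FullSub P => proj1_sig A;
     fmap := fun (A B : FullSub P) (f : Hom A B) => f;
     fmap_id := fun A => eq_refl;
     fmap_comp := fun A B D g f => eq_refl |}.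

Record Pullback (C : Category) (A B D : C) (f : Hom A B) (g : Hom D B) := {
  pb_obj :> C;
  pb_fst : Hom pb_obj A;
  pb_snd : Hom pb_obj D;
  pb_comm : f ∘ pb_fst = g ∘ pb_snd;
  pb_pair : forall (Z : C) (x : Hom Z A) (y : Hom Z D),
    f ∘ x = g ∘ y -> Hom Z pb_obj;
  pb_fst_pair : forall (Z : C) (x : Hom Z A) (y : Hom Z D) (H : f ∘ x = g ∘ y),
    pb_fst ∘ pb_pair H = x;
  pb_snd_pair : forall (Z : C) (x : Hom Z A) (y : Hom Z D) (H : f ∘ x = g ∘ y),
    pb_snd ∘ pb_pair H = y;
  pb_unique : forall (Z : C) (u v : Hom Z pb_obj),
    pb_fst ∘ u = pb_fst ∘ v -> pb_snd ∘ u = pb_snd ∘ v -> u = v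
}.

Arguments pb_fst {C A B D f g} p : rename.
Arguments pb_snd {C A B D f g} p : rename.
Arguments pb_comm {C A B D f g} p : rename.
Arguments pb_pair {C A B D f g} p {Z} x y H : rename.

Definition HasKernelPair (C : Category) (A B : C) (f : Hom A B) : Prop :=
  inhabited (Pullback f f).

Record BinaryProducts (C : Category) := {
  bprod : C -> C -> C;
  bprod_fst : forall A B : C, Hom (bprod A B) A;
  bprod_snd : forall A B : C, Hom (bprod A B) B;
  bprod_pair : forall A B Z : C, Hom Z A -> Hom Z B -> Hom Z (bprod A B);
  bprod_fst_pair : forall (A B Z : C) (x : Hom Z A) (y : Hom Z B),
    bprod_fst A B ∘ bprod_pair x y = x;
  bprod_snd_pair : forall (A B Z : C) (x : Hom Z A) (y : Hom Z B),
    bprod_snd A B ∘ bprod_pair x y = y;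
  bprod_unique : forall (A B Z : C) (u v : Hom Z (bprod A B)),
    bprod_fst A B ∘ u = bprod_fst A B ∘ v ->
    bprod_snd A B ∘ u = bprod_snd A B ∘ v -> u = v
}.

Arguments bprod_fst {C} b A B : rename.
Arguments bprod_snd {C} b A B : rename.
Arguments bprod_pair {C} b {A B Z} x y : rename.

Record TerminalObject (C : Category) := {
  term_obj :> C;
  term_arrow : forall Z : C, Hom Z term_obj;
  term_unique : forall (Z : C) (u v : Hom Z term_obj), u = v
}.

(** The ternary product is [(D × D) × D]. *)
Definition cube_obj (C : Category) (P : BinaryProducts C) (D : C) : C :=
  bprod P (bprod P D D) D.

Definition triple (C : Category) (P : BinaryProducts C) (D Z : C)
    (x y z : Hom Z D) : Hom Z (cube_obj P D) :=
  bprod_pair P (bprod_pair P x y) z.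

Definition cube_1 (C : Category) (P : BinaryProducts C) (D : C) :
    Hom (cube_obj P D) D :=
  bprod_fst P D D ∘ bprod_fst P (bprod P D D) D.

Definition cube_2 (C : Category) (P : BinaryProducts C) (D : C) :
    Hom (cube_obj P D) D :=
  bprod_snd P D D ∘ bprod_fst P (bprod P D D) D.

Definition cube_3 (C : Category) (P : BinaryProducts C) (D : C) :
    Hom (cube_obj P D) D :=
  bprod_snd P (bprod P D D) D.

Definition cube_map (C : Category) (P : BinaryProducts C) (D D' : C)
    (f : Hom D D') : Hom (cube_obj P D) (cube_obj P D') :=
  triple P (f ∘ cube_1 P D) (f ∘ cube_2 P D) (f ∘ cube_3 P D).

Lemma cube_1_triple (C : Category) (P : BinaryProducts C) (D Z : C)
    (x y z : Hom Z D) : cube_1 P D ∘ triple P x y z = x.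
Proof.
  unfold cube_1, triple. now rewrite <- comp_assoc, !bprod_fst_pair.
Qed.

Lemma cube_2_triple (C : Category) (P : BinaryProducts C) (D Z : C)
    (x y z : Hom Z D) : cube_2 P D ∘ triple P x y z = y.
Proof.
  unfold cube_2, triple.
  now rewrite <- comp_assoc, bprod_fst_pair, bprod_snd_pair.
Qed.

Lemma cube_3_triple (C : Category) (P : BinaryProducts C) (D Z : C)
    (x y z : Hom Z D) : cube_3 P D ∘ triple P x y z = z.
Proof. apply bprod_snd_pair. Qed.

Lemma cube_ext (C : Category) (P : BinaryProducts C) (D Z : C)
    (u v : Hom Z (cube_obj P D)) :
  cube_1 P D ∘ u = cube_1 P D ∘ v -> cube_2 P D ∘ u = cube_2 P D ∘ v ->
  cube_3 P D ∘ u = cube_3 P D ∘ v -> u = v.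
Proof.
  unfold cube_1, cube_2; rewrite <- !comp_assoc; intros H1 H2 H3.
  apply bprod_unique; [apply bprod_unique |]; assumption.
Qed.

Lemma cube_id (C : Category) (P : BinaryProducts C) (D : C) :
  cube_map P (idm D) = idm (cube_obj P D).
Proof.
  apply cube_ext; unfold cube_map;
    now rewrite ?cube_1_triple, ?cube_2_triple, ?cube_3_triple,
      comp_idl, comp_idr.
Qed.

Lemma cube_comp (C : Category) (P : BinaryProducts C) (A B D : C)
    (g : Hom B D) (f : Hom A B) :
  cube_map P (g ∘ f) = cube_map P g ∘ cube_map P f.
Proof.
  apply cube_ext; unfold cube_map;
    now rewrite comp_assoc, ?cube_1_triple, ?cube_2_triple, ?cube_3_triple,
      <- !comp_assoc, ?cube_1_triple, ?cube_2_triple, ?cube_3_triple.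
Qed.

Definition Cube (C : Category) (P : BinaryProducts C) : Functor C C :=
  {| fobj := cube_obj P;
     fmap := fun A B f => cube_map P f;
     fmap_id := cube_id P;
     fmap_comp := fun A B D g f => cube_comp P g f |}.

(** The chosen pullback is allowed to depend on the splittings [r] and [s]. *)
Definition LocalProducts (C : Category) : Type :=
  forall (A B D : C) (f : Hom A B) (r : Hom B A) (g : Hom D B) (s : Hom B D),
    f ∘ r = idm B -> g ∘ s = idm B -> Pullback f g.

Lemma lp_e1_comm (C : Category) (A B D : C)
    (f : Hom A B) (g : Hom D B) (s : Hom B D) :
  g ∘ s = idm B -> f ∘ idm A = g ∘ (s ∘ f).
Proof. intros Hg. now rewrite comp_assoc, Hg, comp_idl, comp_idr. Qed.

Lemma lp_e2_comm (C : Category) (A B D : C)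
    (f : Hom A B) (r : Hom B A) (g : Hom D B) :
  f ∘ r = idm B -> f ∘ (r ∘ g) = g ∘ idm D.
Proof. intros Hf. now rewrite comp_assoc, Hf, comp_idl, comp_idr. Qed.

Definition lp_e1 (C : Category) (L : LocalProducts C) (A B D : C)
    (f : Hom A B) (r : Hom B A) (g : Hom D B) (s : Hom B D)
    (Hf : f ∘ r = idm B) (Hg : g ∘ s = idm B) : Hom A (L _ _ _ f r g s Hf Hg) :=
  pb_pair (L _ _ _ f r g s Hf Hg) (idm A) (s ∘ f) (lp_e1_comm f Hg).

Definition lp_e2 (C : Category) (L : LocalProducts C) (A B D : C)
    (f : Hom A B) (r : Hom B A) (g : Hom D B) (s : Hom B D)
    (Hf : f ∘ r = idm B) (Hg : g ∘ s = idm B) : Hom D (L _ _ _ f r g s Hf Hg) :=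
  pb_pair (L _ _ _ f r g s Hf Hg) (r ∘ g) (idm D) (lp_e2_comm g Hf).

Record RGraph (C : Category) := {
  rg1 : C;
  rg0 : C;
  rg_d : Hom rg1 rg0;
  rg_e : Hom rg0 rg1;
  rg_c : Hom rg1 rg0;
  rg_de : rg_d ∘ rg_e = idm rg0;
  rg_ce : rg_c ∘ rg_e = idm rg0
}.

Arguments rg_d {C} r.
Arguments rg_e {C} r.
Arguments rg_c {C} r.

Record RGHom (C : Category) (X Y : RGraph C) := {
  rgh1 : Hom (rg1 X) (rg1 Y);
  rgh0 : Hom (rg0 X) (rg0 Y);
  rgh_d : rg_d Y ∘ rgh1 = rgh0 ∘ rg_d X;
  rgh_c : rg_c Y ∘ rgh1 = rgh0 ∘ rg_c X;
  rgh_e : rgh1 ∘ rg_e X = rg_e Y ∘ rgh0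
}.

Lemma RGHom_eq (C : Category) (X Y : RGraph C) (f g : RGHom X Y) :
  rgh1 f = rgh1 g -> rgh0 f = rgh0 g -> f = g.
Proof.
  destruct f, g; simpl; intros -> ->; f_equal; apply proof_irrelevance.
Qed.

Definition rg_id (C : Category) (X : RGraph C) : RGHom X X.
Proof.
  refine {| rgh1 := idm (rg1 X); rgh0 := idm (rg0 X) |};
    abstract (now rewrite comp_idl, comp_idr).
Defined.

Definition rg_comp (C : Category) (X Y Z : RGraph C)
    (g : RGHom Y Z) (f : RGHom X Y) : RGHom X Z.
Proof.
  refine {| rgh1 := rgh1 g ∘ rgh1 f; rgh0 := rgh0 g ∘ rgh0 f |}.
  - abstract (now rewrite comp_assoc, rgh_d, <- comp_assoc, rgh_d, comp_assoc).
  - abstract (now rewrite comp_assoc, rgh_c, <- comp_assoc, rgh_c, comp_assoc).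
  - abstract (now rewrite <- comp_assoc, rgh_e, comp_assoc, rgh_e, comp_assoc).
Defined.

Definition RG (C : Category) : Category.
Proof.
  refine {| Obj := RGraph C; Hom := @RGHom C;
            idm := @rg_id C; comp := @rg_comp C |}.
  - abstract (intros; apply RGHom_eq; apply comp_idl).
  - abstract (intros; apply RGHom_eq; apply comp_idr).
  - abstract (intros; apply RGHom_eq; apply comp_assoc).
Defined.

Definition rg2 (C : Category) (L : LocalProducts C) (X : RGraph C) :
    Pullback (rg_d X) (rg_c X) :=
  L _ _ _ (rg_d X) (rg_e X) (rg_c X) (rg_e X) (rg_de X) (rg_ce X).

Definition rg_e1 (C : Category) (L : LocalProducts C) (X : RGraph C) :
    Hom (rg1 X) (rg2 L X) :=
  lp_e1 L (rg_de X) (rg_ce X).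

Definition rg_e2 (C : Category) (L : LocalProducts C) (X : RGraph C) :
    Hom (rg1 X) (rg2 L X) :=
  lp_e2 L (rg_de X) (rg_ce X).

Lemma rgh2_comm (C : Category) (L : LocalProducts C) (X Y : RGraph C)
    (f : RGHom X Y) :
  rg_d Y ∘ (rgh1 f ∘ pb_fst (rg2 L X)) = rg_c Y ∘ (rgh1 f ∘ pb_snd (rg2 L X)).
Proof.
  now rewrite !comp_assoc, rgh_d, rgh_c, <- !comp_assoc, pb_comm.
Qed.

(** [f1 ×_{f0} f1] *)
Definition rgh2 (C : Category) (L : LocalProducts C) (X Y : RGraph C)
    (f : RGHom X Y) : Hom (rg2 L X) (rg2 L Y) :=
  pb_pair (rg2 L Y) (rgh1 f ∘ pb_fst (rg2 L X)) (rgh1 f ∘ pb_snd (rg2 L X))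
    (rgh2_comm L f).

Record UMGraph (C : Category) (L : LocalProducts C) := {
  um_rg :> RGraph C;
  um_m : Hom (rg2 L um_rg) (rg1 um_rg);
  um_dm : rg_d um_rg ∘ um_m = rg_d um_rg ∘ pb_snd (rg2 L um_rg);
  um_cm : rg_c um_rg ∘ um_m = rg_c um_rg ∘ pb_fst (rg2 L um_rg);
  um_me1 : um_m ∘ rg_e1 L um_rg = idm (rg1 um_rg);
  um_me2 : um_m ∘ rg_e2 L um_rg = idm (rg1 um_rg)
}.

Arguments um_m {C L} u.

Record UMHom (C : Category) (L : LocalProducts C) (X Y : UMGraph L) := {
  umh_rg :> RGHom X Y;
  umh_m : rgh1 umh_rg ∘ um_m X = um_m Y ∘ rgh2 L umh_rg
}.

Lemma UMHom_eq (C : Category) (L : LocalProducts C) (X Y : UMGraph L)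
    (f g : UMHom X Y) :
  umh_rg f = umh_rg g -> f = g.
Proof.
  destruct f, g; simpl; intros ->; f_equal; apply proof_irrelevance.
Qed.

Lemma rgh2_id (C : Category) (L : LocalProducts C) (X : RGraph C) :
  rgh2 L (rg_id X) = idm (rg2 L X).
Proof.
  apply pb_unique; unfold rgh2; rewrite ?pb_fst_pair, ?pb_snd_pair, comp_idr;
    apply comp_idl.
Qed.

Lemma rgh2_comp (C : Category) (L : LocalProducts C) (X Y Z : RGraph C)
    (g : RGHom Y Z) (f : RGHom X Y) :
  rgh2 L (rg_comp g f) = rgh2 L g ∘ rgh2 L f.
Proof.
  apply pb_unique; unfold rgh2;
    rewrite comp_assoc, ?pb_fst_pair, ?pb_snd_pair, <- comp_assoc,
      ?pb_fst_pair, ?pb_snd_pair, comp_assoc; reflexivity.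
Qed.

Definition um_id (C : Category) (L : LocalProducts C) (X : UMGraph L) :
    UMHom X X.
Proof.
  refine {| umh_rg := rg_id X |}.
  abstract (rewrite rgh2_id, comp_idr; apply comp_idl).
Defined.

Definition um_comp (C : Category) (L : LocalProducts C) (X Y Z : UMGraph L)
    (g : UMHom Y Z) (f : UMHom X Y) : UMHom X Z.
Proof.
  refine {| umh_rg := rg_comp g f |}.
  abstract (rewrite rgh2_comp; simpl;
            now rewrite <- comp_assoc, umh_m, !comp_assoc, umh_m).
Defined.

Definition UMG (C : Category) (L : LocalProducts C) : Category.
Proof.
  refine {| Obj := UMGraph L; Hom := @UMHom C L;
            idm := @um_id C L; comp := @um_comp C L |}.
  - abstract (intros; apply UMHom_eq, RGHom_eq; apply comp_idl).
  - abstract (intros; apply UMHom_eq, RGHom_eq; apply comp_idr).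
  - abstract (intros; apply UMHom_eq, RGHom_eq; apply comp_assoc).
Defined.

Definition forgetUMG (C : Category) (L : LocalProducts C) :
    Functor (UMG L) (RG C) :=
  {| fobj := fun X : UMG L => um_rg X : RG C;
     fmap := fun (X Y : UMG L) (f : Hom X Y) => umh_rg f;
     fmap_id := fun X => eq_refl;
     fmap_comp := fun X Y Z g f => eq_refl |}.

(** [m⟨x, y⟩] for generalized elements [x], [y] of [C1] with [dx = cy]. *)
Definition mul (C : Category) (L : LocalProducts C) (X : UMGraph L) (Z : C)
    (x y : Hom Z (rg1 X)) (H : rg_d X ∘ x = rg_c X ∘ y) : Hom Z (rg1 X) :=
  um_m X ∘ pb_pair (rg2 L X) x y H.

Lemma mul_d (C : Category) (L : LocalProducts C) (X : UMGraph L) (Z : C)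
    (x y : Hom Z (rg1 X)) (H : rg_d X ∘ x = rg_c X ∘ y) :
  rg_d X ∘ mul H = rg_d X ∘ y.
Proof.
  unfold mul. now rewrite comp_assoc, um_dm, <- comp_assoc, pb_snd_pair.
Qed.

Lemma mul_c (C : Category) (L : LocalProducts C) (X : UMGraph L) (Z : C)
    (x y : Hom Z (rg1 X)) (H : rg_d X ∘ x = rg_c X ∘ y) :
  rg_c X ∘ mul H = rg_c X ∘ x.
Proof.
  unfold mul. now rewrite comp_assoc, um_cm, <- comp_assoc, pb_fst_pair.
Qed.

Arguments mul {C L} X {Z} x y H.

Definition Associative (C : Category) (L : LocalProducts C) (X : UMGraph L) :
    Prop :=
  forall (Z : C) (x y z : Hom Z (rg1 X))
    (Hxy : rg_d X ∘ x = rg_c X ∘ y) (Hyz : rg_d X ∘ y = rg_c X ∘ z),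
    mul X (mul X x y Hxy) z (eq_trans (mul_d Hxy) Hyz) =
    mul X x (mul X y z Hyz) (eq_trans Hxy (eq_sym (mul_c Hyz))).

Definition HasInverses (C : Category) (L : LocalProducts C) (X : UMGraph L) :
    Prop :=
  exists (i : Hom (rg1 X) (rg1 X))
    (Hd : rg_d X ∘ i = rg_c X) (Hc : rg_c X ∘ i = rg_d X),
    mul X (idm (rg1 X)) i (eq_trans (comp_idr (rg_d X)) (eq_sym Hc)) =
      rg_e X ∘ rg_c X /\
    mul X i (idm (rg1 X)) (eq_trans Hd (eq_sym (comp_idr (rg_c X)))) =
      rg_e X ∘ rg_d X.

Definition Cat (C : Category) (L : LocalProducts C) : Category :=
  FullSub (X := UMG L) (@Associative C L).

Definition Grpd (C : Category) (L : LocalProducts C) : Category :=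
  FullSub (X := Cat L) (fun X => HasInverses (proj1_sig X)).

Definition forgetCat (C : Category) (L : LocalProducts C) :
    Functor (Cat L) (RG C) :=
  compF (forgetUMG L) (inclusion (X := UMG L) _).

Definition forgetGrpd (C : Category) (L : LocalProducts C) :
    Functor (Grpd L) (RG C) :=
  compF (forgetCat L) (inclusion (X := Cat L) _).

Definition JointlyMonic (C : Category) (E A B : C)
    (p1 : Hom E A) (p2 : Hom E B) : Prop :=
  forall (Z : C) (u v : Hom Z E), p1 ∘ u = p1 ∘ v -> p2 ∘ u = p2 ∘ v -> u = v.

Definition KiteCondition (C : Category) : Prop :=
  forall (A B E D D0 D1 : C)
    (p1 : Hom E A) (e1 : Hom A E) (p2 : Hom E B) (e2 : Hom B E)
    (alpha : Hom A D) (beta : Hom E D) (gamma : Hom B D)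
    (d : Hom D D0) (c : Hom D D1),
    p1 ∘ e1 = idm A ->
    p2 ∘ e2 = idm B ->
    (e1 ∘ p1) ∘ (e2 ∘ p2) = (e2 ∘ p2) ∘ (e1 ∘ p1) ->
    JointlyMonic p1 p2 ->
    alpha ∘ p1 ∘ e2 ∘ p2 = beta ->
    beta = gamma ∘ p2 ∘ e1 ∘ p1 ->
    d ∘ alpha ∘ p1 = d ∘ alpha ∘ p1 ∘ e2 ∘ p2 ->
    c ∘ gamma ∘ p2 = c ∘ gamma ∘ p2 ∘ e1 ∘ p1 ->
    HasKernelPair d ->
    HasKernelPair c ->
    exists! m : Hom E D,
      m ∘ e1 = alpha /\ m ∘ e2 = gamma /\
      d ∘ m = d ∘ gamma ∘ p2 /\ c ∘ m = c ∘ alpha ∘ p1.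

(* Main.v *)
(** From a section of [Cat → RG], equip the object of triples [(x, w, z)] with
    [c x = c w] and [d w = d z] with its reflexive graph structure over [D],
    given by [z] and [x].  The composite of [(x, x, y)] and [(y, z, z)] has the
    form [(x, p(x, y, z), z)], and [p] is a Mal'tsev operation defined when
    [d x = d y] and [c y = c z]; the morphism required by the Kite Condition is
    [p(α p1, β, γ p2)].  It is the only one because [p] is natural and, by joint
    monicity, the identity of [E] is [p(e1 p1, e1 p1 e2 p2, e2 p2)], computed
    with respect to [p2] and [p1].

    Conversely, the uniqueness in the Kite Condition makes multiplications
    unique, associative and preserved by all graph morphisms.  Inverses come
    from the Mal'tsev operation on the object of composable pairs: applied to
    [(x, 1)], [(1, x)], [(1, 1)], where the first two have the same composite and
    the last two the same first component, it gives a pair [(x, i)] with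
    composite [1]. *)
From Stdlib Require Import ProofIrrelevance FunctionalExtensionality.
From Stdlib Require Import IndefiniteDescription.
Require Import Defs.

Local Open Scope cat_scope.

(** * Strict equality of functors and isomorphisms of categories *)

Lemma comp_whisker {C : Category} {A B D Z : C} {f : Hom B D} {g : Hom A B}
    {h : Hom A D} (H : f ∘ g = h) (k : Hom Z A) : f ∘ (g ∘ k) = h ∘ k.
Proof. now rewrite comp_assoc, H. Qed.

Lemma comp_square {C : Category} {A B B' D Z : C} {f : Hom B D} {x : Hom A B}
    {g : Hom B' D} {y : Hom A B'} (H : f ∘ x = g ∘ y) (u : Hom Z A) :
  f ∘ (x ∘ u) = g ∘ (y ∘ u).
Proof. now rewrite !comp_assoc, H. Qed.

(** Packing a morphism with its endpoints allows comparison of morphisms whose endpoints are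
    provably but not definitionally equal, with no transport in the statement. *)
Definition arrow {X : Category} {A B : X} (f : Hom A B) :
    {A : X & {B : X & Hom A B}} :=
  existT _ A (existT _ B f).

Lemma arrow_inj {X : Category} {A B : X} (f g : Hom A B) :
  arrow f = arrow g -> f = g.
Proof. intros H. now do 2 apply inj_pair2 in H. Qed.

(** The packed equation at an identity already contains the equality of the object parts; once these
    are identified, [arrow_inj] gives the morphism parts. *)
Lemma functor_ext {X Y : Category} (F G : Functor X Y) :
  (forall (A B : X) (f : Hom A B), arrow (fmap F f) = arrow (fmap G f)) -> F = G.
Proof.
  destruct F as [fo fm fi fc], G as [go gm gi gc]; simpl; intros H.
  assert (fo = go) as <-.
  { extensionality A. exact (f_equal (@projT1 _ _) (H A A (idm A))). }
  assert (fm = gm) as <-.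
  { extensionality A; extensionality B; extensionality f.
    apply arrow_inj, H. }
  f_equal; apply proof_irrelevance.
Qed.

(** From [F (G (F f)) = F f], injectivity on objects and faithfulness cancel the outer [F], so a
    one-sided inverse is two-sided. *)
Lemma section_iso {X Y : Category} (F : Functor X Y) (G : Functor Y X) :
  (forall A B : X, F A = F B -> A = B) ->
  (forall (A B : X) (f g : Hom A B), fmap F f = fmap F g -> f = g) ->
  compF F G = idF Y -> IsoOfCategories F.
Proof.
  intros Hinj Hfaith H. exists G; split; [exact H |].
  apply functor_ext; intros A B f; simpl.
  assert (E : arrow (fmap F (fmap G (fmap F f))) = arrow (fmap F f)).
  { exact (f_equal (fun K : Functor Y Y => arrow (fmap K (fmap F f))) H). }
  (* The endpoints [G (F A)] and [G (F B)] become variables, so that the equalities obtained by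
     injectivity can be substituted. *)
  revert E. generalize (fmap G (fmap F f)).
  generalize (G (F A)), (G (F B)); intros A' B' g E.
  assert (A' = A) as ->.
  { apply Hinj. exact (f_equal (@projT1 _ _) E). }
  apply inj_pair2 in E.
  assert (B' = B) as ->.
  { apply Hinj. exact (f_equal (@projT1 _ _) E). }
  apply inj_pair2 in E. now rewrite (Hfaith _ _ _ _ E).
Qed.

Lemma iso_section {X Y : Category} (F : Functor X Y) :
  IsoOfCategories F -> HasSection F.
Proof. intros [G [H _]]. now exists G. Qed.

(** * Generalized elements of pullbacks and their products *)

(** A local product whose two split legs coincide is a kernel pair. This discharges the kernel pair
    conditions of the Kite Condition for all split [d] and [c]. *)
Lemma split_kernel_pair {C : Category} (L : LocalProducts C) {A B : C}
    (f : Hom A B) (r : Hom B A) : f ∘ r = idm B -> HasKernelPair f.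
Proof. intros H. exact (inhabits (L _ _ _ f r f r H H)). Qed.

Lemma pb_pair_comp {C : Category} {A B D : C} {f : Hom A B} {g : Hom D B}
    (P : Pullback f g) {Z W : C} (x : Hom Z A) (y : Hom Z D)
    (H : f ∘ x = g ∘ y) (u : Hom W Z) (H' : f ∘ (x ∘ u) = g ∘ (y ∘ u)) :
  pb_pair P x y H ∘ u = pb_pair P (x ∘ u) (y ∘ u) H'.
Proof.
  apply pb_unique; now rewrite comp_assoc, ?pb_fst_pair, ?pb_snd_pair.
Qed.

Lemma pb_pair_eq {C : Category} {A B D : C} {f : Hom A B} {g : Hom D B}
    (P : Pullback f g) {Z : C} (x x' : Hom Z A) (y y' : Hom Z D)
    (H : f ∘ x = g ∘ y) (H' : f ∘ x' = g ∘ y') :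
  x = x' -> y = y' -> pb_pair P x y H = pb_pair P x' y' H'.
Proof.
  intros -> ->. apply pb_unique; now rewrite ?pb_fst_pair, ?pb_snd_pair.
Qed.

Lemma mul_comp {C : Category} {L : LocalProducts C} (X : UMGraph L) {Z W : C}
    (x y : Hom Z (rg1 X)) (H : rg_d X ∘ x = rg_c X ∘ y) (u : Hom W Z)
    (x' y' : Hom W (rg1 X)) (H' : rg_d X ∘ x' = rg_c X ∘ y') :
  x ∘ u = x' -> y ∘ u = y' -> mul X x y H ∘ u = mul X x' y' H'.
Proof.
  intros <- <-. unfold mul. now rewrite <- comp_assoc, (pb_pair_comp _ _ _ _ _ H').
Qed.

Lemma mul_eq {C : Category} {L : LocalProducts C} (X : UMGraph L) {Z : C}
    (x x' y y' : Hom Z (rg1 X)) (H : rg_d X ∘ x = rg_c X ∘ y)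
    (H' : rg_d X ∘ x' = rg_c X ∘ y') :
  x = x' -> y = y' -> mul X x y H = mul X x' y' H'.
Proof. intros Hx Hy. unfold mul. f_equal. now apply pb_pair_eq. Qed.

(** The unit is described by an equation on [y], so that the lemma rewrites a product whatever the
    form of its second factor and of the proof [H]. *)
Lemma mul_unit_r {C : Category} {L : LocalProducts C} (X : UMGraph L) {Z : C}
    (x y : Hom Z (rg1 X)) (H : rg_d X ∘ x = rg_c X ∘ y) :
  y = rg_e X ∘ (rg_d X ∘ x) -> mul X x y H = x.
Proof.
  intros Hy. rewrite <- (comp_idl x) at 2. rewrite <- (um_me1 X).
  unfold mul. rewrite <- comp_assoc. f_equal.
  unfold rg_e1, lp_e1. apply pb_unique;
    rewrite comp_assoc, ?pb_fst_pair, ?pb_snd_pair.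
  - now rewrite comp_idl.
  - now rewrite <- comp_assoc.
Qed.

Lemma mul_projections {C : Category} {L : LocalProducts C} (X : UMGraph L) :
  mul X (pb_fst (rg2 L X)) (pb_snd (rg2 L X)) (pb_comm (rg2 L X)) = um_m X.
Proof.
  unfold mul. rewrite <- (comp_idr (um_m X)) at 2. f_equal.
  apply pb_unique; now rewrite ?pb_fst_pair, ?pb_snd_pair, comp_idr.
Qed.

Lemma mul_unit_l {C : Category} {L : LocalProducts C} (X : UMGraph L) {Z : C}
    (x y : Hom Z (rg1 X)) (H : rg_d X ∘ x = rg_c X ∘ y) :
  x = rg_e X ∘ (rg_c X ∘ y) -> mul X x y H = y.
Proof.
  intros Hx. rewrite <- (comp_idl y) at 2. rewrite <- (um_me2 X).
  unfold mul. rewrite <- comp_assoc. f_equal.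
  unfold rg_e2, lp_e2. apply pb_unique;
    rewrite comp_assoc, ?pb_fst_pair, ?pb_snd_pair.
  - now rewrite <- comp_assoc.
  - now rewrite comp_idl.
Qed.

(** * The Kite Condition on a local product *)

(** Both sides are [⟨r, s⟩]. *)
Lemma lp_e1_comp {C : Category} (L : LocalProducts C) {A B D : C}
    (f : Hom A B) (r : Hom B A) (g : Hom D B) (s : Hom B D)
    (Hf : f ∘ r = idm B) (Hg : g ∘ s = idm B) :
  lp_e1 L Hf Hg ∘ r = lp_e2 L Hf Hg ∘ s.
Proof.
  unfold lp_e1, lp_e2. apply pb_unique;
    rewrite !comp_assoc, ?pb_fst_pair, ?pb_snd_pair, <- comp_assoc.
  - now rewrite comp_idl, Hg, comp_idr.
  - now rewrite comp_idl, Hf, comp_idr.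
Qed.

(** A local product is a kite: its two idempotents commute because both composites are [⟨r, s⟩]
    after the common morphism to [B], and by [alpha ∘ r = gamma ∘ s] the two expressions for [beta]
    agree. *)
Lemma kite_lp {C : Category} (K : KiteCondition C) (L : LocalProducts C)
    {A B E D D0 D1 : C}
    (f : Hom A B) (r : Hom B A) (g : Hom E B) (s : Hom B E)
    (Hf : f ∘ r = idm B) (Hg : g ∘ s = idm B)
    (alpha : Hom A D) (gamma : Hom E D) (d : Hom D D0) (c : Hom D D1) :
  alpha ∘ r = gamma ∘ s ->
  d ∘ alpha = d ∘ alpha ∘ r ∘ f ->
  c ∘ gamma = c ∘ gamma ∘ s ∘ g ->
  HasKernelPair d -> HasKernelPair c ->
  exists! m : Hom (L _ _ _ f r g s Hf Hg) D,
    m ∘ lp_e1 L Hf Hg = alpha /\ m ∘ lp_e2 L Hf Hg = gamma /\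
    d ∘ m = d ∘ gamma ∘ pb_snd (L _ _ _ f r g s Hf Hg) /\
    c ∘ m = c ∘ alpha ∘ pb_fst (L _ _ _ f r g s Hf Hg).
Proof.
  intros Hag Hd Hc Kd Kc.
  set (P := L _ _ _ f r g s Hf Hg).
  assert (P11 : pb_fst P ∘ lp_e1 L Hf Hg = idm A) by apply pb_fst_pair.
  assert (P22 : pb_snd P ∘ lp_e2 L Hf Hg = idm E) by apply pb_snd_pair.
  assert (P12 : pb_fst P ∘ lp_e2 L Hf Hg = r ∘ g) by apply pb_fst_pair.
  assert (P21 : pb_snd P ∘ lp_e1 L Hf Hg = s ∘ f) by apply pb_snd_pair.
  refine (K A E P D D0 D1 (pb_fst P) (lp_e1 L Hf Hg) (pb_snd P)
            (lp_e2 L Hf Hg) alpha (alpha ∘ pb_fst P ∘ lp_e2 L Hf Hg ∘ pb_snd P)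
            gamma d c P11 P22 _ _ eq_refl _ _ _ Kd Kc).
  - rewrite <- !comp_assoc.
    rewrite (comp_whisker P12), (comp_whisker P21), <- !comp_assoc.
    rewrite (comp_whisker (lp_e1_comp L f r g s Hf Hg)), <- pb_comm.
    now rewrite <- !comp_assoc.
  - intros Z u v. apply pb_unique.
  - rewrite <- !comp_assoc.
    rewrite (comp_whisker P12), (comp_whisker P21), <- !comp_assoc.
    now rewrite (comp_whisker Hag), pb_comm, <- comp_assoc.
  - rewrite Hd at 1. rewrite <- !comp_assoc, (comp_whisker P12).
    now rewrite pb_comm, <- !comp_assoc.
  - rewrite Hc at 1. rewrite <- !comp_assoc, (comp_whisker P21).
    now rewrite <- pb_comm, <- !comp_assoc.
Qed.

Lemma exists_unique_eq {T : Type} {Q : T -> Prop} (x y : T) :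
  (exists! z, Q z) -> Q x -> Q y -> x = y.
Proof.
  intros [z [_ U]] Hx Hy. now rewrite <- (U x Hx), <- (U y Hy).
Qed.

(** * The reflexive graph of triples *)

Definition kp_diag {C : Category} {A B : C} {f : Hom A B} (K : Pullback f f) :
    Hom A K :=
  pb_pair K (idm A) (idm A) eq_refl.

Lemma kp_fst_diag {C : Category} {A B : C} {f : Hom A B} (K : Pullback f f) :
  pb_fst K ∘ kp_diag K = idm A.
Proof. apply pb_fst_pair. Qed.

Lemma kp_snd_diag {C : Category} {A B : C} {f : Hom A B} (K : Pullback f f) :
  pb_snd K ∘ kp_diag K = idm A.
Proof. apply pb_snd_pair. Qed.

(** The object of triples [(x, w, z)] with [c x = c w] and [d w = d z]. *)
Definition span {C : Category} (L : LocalProducts C) {D D0 D1 : C}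
    {d : Hom D D0} {c : Hom D D1} (Kc : Pullback c c) (Kd : Pullback d d) :
    Pullback (pb_snd Kc) (pb_fst Kd) :=
  L _ _ _ (pb_snd Kc) (kp_diag Kc) (pb_fst Kd) (kp_diag Kd)
    (kp_snd_diag Kc) (kp_fst_diag Kd).

Definition span1 {C : Category} (L : LocalProducts C) {D D0 D1 : C}
    {d : Hom D D0} {c : Hom D D1} (Kc : Pullback c c) (Kd : Pullback d d) :
    Hom (span L Kc Kd) D :=
  pb_fst Kc ∘ pb_fst (span L Kc Kd).

Definition span2 {C : Category} (L : LocalProducts C) {D D0 D1 : C}
    {d : Hom D D0} {c : Hom D D1} (Kc : Pullback c c) (Kd : Pullback d d) :
    Hom (span L Kc Kd) D :=
  pb_snd Kc ∘ pb_fst (span L Kc Kd).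

Definition span3 {C : Category} (L : LocalProducts C) {D D0 D1 : C}
    {d : Hom D D0} {c : Hom D D1} (Kc : Pullback c c) (Kd : Pullback d d) :
    Hom (span L Kc Kd) D :=
  pb_snd Kd ∘ pb_snd (span L Kc Kd).

Lemma span_comm12 {C : Category} (L : LocalProducts C) {D D0 D1 : C}
    {d : Hom D D0} {c : Hom D D1} (Kc : Pullback c c) (Kd : Pullback d d) :
  c ∘ span1 L Kc Kd = c ∘ span2 L Kc Kd.
Proof. unfold span1, span2. now rewrite !comp_assoc, pb_comm. Qed.

Lemma span_comm23 {C : Category} (L : LocalProducts C) {D D0 D1 : C}
    {d : Hom D D0} {c : Hom D D1} (Kc : Pullback c c) (Kd : Pullback d d) :
  d ∘ span2 L Kc Kd = d ∘ span3 L Kc Kd.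
Proof.
  unfold span2, span3. now rewrite (pb_comm (span L Kc Kd)), !comp_assoc, pb_comm.
Qed.

Lemma span_ext {C : Category} (L : LocalProducts C) {D D0 D1 : C}
    {d : Hom D D0} {c : Hom D D1} (Kc : Pullback c c) (Kd : Pullback d d)
    {Z : C} (u v : Hom Z (span L Kc Kd)) :
  span1 L Kc Kd ∘ u = span1 L Kc Kd ∘ v ->
  span2 L Kc Kd ∘ u = span2 L Kc Kd ∘ v ->
  span3 L Kc Kd ∘ u = span3 L Kc Kd ∘ v -> u = v.
Proof.
  unfold span1, span2, span3. rewrite <- !comp_assoc. intros H1 H2 H3.
  apply pb_unique; apply pb_unique; try assumption.
  (* The remaining goal is about the first projection of [Kd]; the pullback square turns it into the
     middle component. *)
  now rewrite !comp_assoc, <- !(pb_comm (span L Kc Kd)), <- !comp_assoc.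
Qed.

Lemma span_pair {C : Category} (L : LocalProducts C) {D D0 D1 : C}
    {d : Hom D D0} {c : Hom D D1} (Kc : Pullback c c) (Kd : Pullback d d)
    {Z : C} (x w z : Hom Z D) (H1 : c ∘ x = c ∘ w) (H2 : d ∘ w = d ∘ z) :
  pb_snd Kc ∘ pb_pair Kc x w H1 = pb_fst Kd ∘ pb_pair Kd w z H2.
Proof. now rewrite pb_snd_pair, pb_fst_pair. Qed.

Definition span_mk {C : Category} (L : LocalProducts C) {D D0 D1 : C}
    {d : Hom D D0} {c : Hom D D1} (Kc : Pullback c c) (Kd : Pullback d d)
    {Z : C} (x w z : Hom Z D) (H1 : c ∘ x = c ∘ w) (H2 : d ∘ w = d ∘ z) :
    Hom Z (span L Kc Kd) :=
  pb_pair (span L Kc Kd) (pb_pair Kc x w H1) (pb_pair Kd w z H2)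
    (span_pair L Kc Kd x w z H1 H2).

Lemma span1_mk {C : Category} (L : LocalProducts C) {D D0 D1 : C}
    {d : Hom D D0} {c : Hom D D1} (Kc : Pullback c c) (Kd : Pullback d d)
    {Z : C} (x w z : Hom Z D) (H1 : c ∘ x = c ∘ w) (H2 : d ∘ w = d ∘ z) :
  span1 L Kc Kd ∘ span_mk L Kc Kd x w z H1 H2 = x.
Proof. unfold span1, span_mk. now rewrite <- comp_assoc, !pb_fst_pair. Qed.

Lemma span2_mk {C : Category} (L : LocalProducts C) {D D0 D1 : C}
    {d : Hom D D0} {c : Hom D D1} (Kc : Pullback c c) (Kd : Pullback d d)
    {Z : C} (x w z : Hom Z D) (H1 : c ∘ x = c ∘ w) (H2 : d ∘ w = d ∘ z) :
  span2 L Kc Kd ∘ span_mk L Kc Kd x w z H1 H2 = w.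
Proof.
  unfold span2, span_mk. now rewrite <- comp_assoc, pb_fst_pair, pb_snd_pair.
Qed.

Lemma span3_mk {C : Category} (L : LocalProducts C) {D D0 D1 : C}
    {d : Hom D D0} {c : Hom D D1} (Kc : Pullback c c) (Kd : Pullback d d)
    {Z : C} (x w z : Hom Z D) (H1 : c ∘ x = c ∘ w) (H2 : d ∘ w = d ∘ z) :
  span3 L Kc Kd ∘ span_mk L Kc Kd x w z H1 H2 = z.
Proof. unfold span3, span_mk. now rewrite <- comp_assoc, !pb_snd_pair. Qed.

Lemma span_mk_comp {C : Category} (L : LocalProducts C) {D D0 D1 : C}
    {d : Hom D D0} {c : Hom D D1} (Kc : Pullback c c) (Kd : Pullback d d)
    {Z W : C} (x w z : Hom Z D) (H1 : c ∘ x = c ∘ w) (H2 : d ∘ w = d ∘ z)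
    (u : Hom W Z) (x' w' z' : Hom W D) (H1' : c ∘ x' = c ∘ w')
    (H2' : d ∘ w' = d ∘ z') :
  x ∘ u = x' -> w ∘ u = w' -> z ∘ u = z' ->
  span_mk L Kc Kd x w z H1 H2 ∘ u = span_mk L Kc Kd x' w' z' H1' H2'.
Proof.
  intros Hx Hw Hz.
  apply span_ext; rewrite comp_assoc, ?span1_mk, ?span2_mk, ?span3_mk;
    assumption.
Qed.

Definition span_graph {C : Category} (L : LocalProducts C) {D D0 D1 : C}
    {d : Hom D D0} {c : Hom D D1} (Kc : Pullback c c) (Kd : Pullback d d) :
    RGraph C :=
  {| rg1 := span L Kc Kd;
     rg0 := D;
     rg_d := span3 L Kc Kd;
     rg_e := span_mk L Kc Kd (idm D) (idm D) (idm D) eq_refl eq_refl;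
     rg_c := span1 L Kc Kd;
     rg_de := span3_mk L Kc Kd _ _ _ _ _;
     rg_ce := span1_mk L Kc Kd _ _ _ _ _ |}.

(** * Natural multiplications from a section *)

(** The equations follow the order of the conclusion of the Kite Condition for [alpha] and [gamma]
    identities. *)
Definition IsMult {C : Category} (L : LocalProducts C) (X : RGraph C)
    (m : Hom (rg2 L X) (rg1 X)) : Prop :=
  m ∘ rg_e1 L X = idm (rg1 X) /\ m ∘ rg_e2 L X = idm (rg1 X) /\
  rg_d X ∘ m = rg_d X ∘ pb_snd (rg2 L X) /\
  rg_c X ∘ m = rg_c X ∘ pb_fst (rg2 L X).

Lemma um_is_mult {C : Category} {L : LocalProducts C} (X : UMGraph L) :
  IsMult L X (um_m X).
Proof.
  repeat split; [apply um_me1 | apply um_me2 | apply um_dm | apply um_cm].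
Qed.

Definition umg {C : Category} (L : LocalProducts C) (X : RGraph C)
    (m : Hom (rg2 L X) (rg1 X)) (H : IsMult L X m) : UMGraph L :=
  {| um_rg := X;
     um_m := m;
     um_dm := proj1 (proj2 (proj2 H));
     um_cm := proj2 (proj2 (proj2 H));
     um_me1 := proj1 H;
     um_me2 := proj1 (proj2 H) |}.

Lemma section_mult {C : Category} (L : LocalProducts C) :
  HasSection (forgetCat L) ->
  exists (m : forall X : RGraph C, Hom (rg2 L X) (rg1 X)),
    (forall X : RGraph C, IsMult L X (m X)) /\
    forall (X Y : RGraph C) (f : RGHom X Y),
      rgh1 f ∘ m X = m Y ∘ rgh2 L f.
Proof.
  intros [S H].
  (* The type of a multiplication depends on the graph. Stating the claim for an arbitrary
     endofunctor [T] lets the equation between functors be rewritten at once on objects and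
     morphisms. *)
  set (Q := fun T : Functor (RG C) (RG C) =>
    exists (m : forall X : RGraph C, Hom (rg2 L (T X)) (rg1 (T X))),
      (forall X : RGraph C, IsMult L (T X) (m X)) /\
      forall (X Y : RGraph C) (f : RGHom X Y),
        rgh1 (fmap T (f : Hom (c := RG C) X Y)) ∘ m X =
        m Y ∘ rgh2 L (fmap T (f : Hom (c := RG C) X Y))).
  change (Q (idF (RG C))). rewrite <- H.
  exists (fun X => um_m (proj1_sig (S X))). split.
  - intros X. apply um_is_mult.
  - intros X Y f. exact (umh_m (fmap S (f : Hom (c := RG C) X Y))).
Qed.

Lemma section_mul {C : Category} (L : LocalProducts C) :
  HasSection (forgetCat L) ->
  exists (m : forall X : RGraph C, Hom (rg2 L X) (rg1 X))
    (M : forall X : RGraph C, IsMult L X (m X)),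
    forall (X Y : RGraph C) (f : RGHom X Y) (Z : C) (x y : Hom Z (rg1 X))
      (H : rg_d X ∘ x = rg_c X ∘ y)
      (H' : rg_d Y ∘ (rgh1 f ∘ x) = rg_c Y ∘ (rgh1 f ∘ y)),
      rgh1 f ∘ mul (umg L X (m X) (M X)) x y H =
      mul (umg L Y (m Y) (M Y)) (rgh1 f ∘ x) (rgh1 f ∘ y) H'.
Proof.
  intros HS. destruct (section_mult L HS) as [m [M N]].
  exists m, M. intros X Y f Z x y H H'. unfold mul; simpl.
  rewrite comp_assoc, N, <- comp_assoc. f_equal.
  apply pb_unique; unfold rgh2;
    now rewrite comp_assoc, ?pb_fst_pair, ?pb_snd_pair, <- comp_assoc,
      ?pb_fst_pair, ?pb_snd_pair.
Qed.

(** * The partial Mal'tsev operation of a natural multiplication *)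

Lemma span_map_comm {C : Category} {D D' D1 D1' : C} {c : Hom D D1}
    {c' : Hom D' D1'} (f : Hom D D') (k : Hom D1 D1') :
  c' ∘ f = k ∘ c -> forall (Z : C) (x y : Hom Z D),
  c ∘ x = c ∘ y -> c' ∘ (f ∘ x) = c' ∘ (f ∘ y).
Proof. intros H Z x y Hxy. now rewrite !comp_assoc, H, <- !comp_assoc, Hxy. Qed.

Definition span_map {C : Category} (L : LocalProducts C) {D D0 D1 D' D0' D1' : C}
    {d : Hom D D0} {c : Hom D D1} (Kc : Pullback c c) (Kd : Pullback d d)
    {d' : Hom D' D0'} {c' : Hom D' D1'} (Kc' : Pullback c' c')
    (Kd' : Pullback d' d') (f : Hom D D') (k : Hom D1 D1') (l : Hom D0 D0')
    (Hk : c' ∘ f = k ∘ c) (Hl : d' ∘ f = l ∘ d) :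
    RGHom (span_graph L Kc Kd) (span_graph L Kc' Kd').
Proof.
  refine {| rgh1 := span_mk L Kc' Kd' (f ∘ span1 L Kc Kd) (f ∘ span2 L Kc Kd)
                      (f ∘ span3 L Kc Kd)
                      (span_map_comm f k Hk _ _ _ (span_comm12 L Kc Kd))
                      (span_map_comm f l Hl _ _ _ (span_comm23 L Kc Kd))
                      : Hom (rg1 (span_graph L Kc Kd))
                          (rg1 (span_graph L Kc' Kd'));
            rgh0 := f : Hom (rg0 (span_graph L Kc Kd))
                          (rg0 (span_graph L Kc' Kd')) |}.
  - apply span3_mk.
  - apply span1_mk.
  - simpl. apply span_ext;
      now rewrite !comp_assoc, ?span1_mk, ?span2_mk, ?span3_mk, <- ?comp_assoc,
        ?span1_mk, ?span2_mk, ?span3_mk, ?comp_idl, ?comp_idr.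
Defined.

Definition span_op {C : Category} {L : LocalProducts C} {D D0 D1 : C}
    {d : Hom D D0} {c : Hom D D1} {Kc : Pullback c c} {Kd : Pullback d d}
    {m : Hom (rg2 L (span_graph L Kc Kd)) (rg1 (span_graph L Kc Kd))}
    (M : IsMult L (span_graph L Kc Kd) m) {Z : C} (x y z : Hom Z D)
    (Hd : d ∘ x = d ∘ y) (Hc : c ∘ y = c ∘ z) : Hom Z D :=
  span2 L Kc Kd ∘
  mul (umg L (span_graph L Kc Kd) m M)
    (span_mk L Kc Kd x x y eq_refl Hd) (span_mk L Kc Kd y z z Hc eq_refl)
    (eq_trans (span3_mk L Kc Kd _ _ _ _ _) (eq_sym (span1_mk L Kc Kd _ _ _ _ _))).

Section SpanOp.
Context {C : Category} {L : LocalProducts C} {D D0 D1 : C}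
  {d : Hom D D0} {c : Hom D D1} {Kc : Pullback c c} {Kd : Pullback d d}
  {m : Hom (rg2 L (span_graph L Kc Kd)) (rg1 (span_graph L Kc Kd))}
  (M : IsMult L (span_graph L Kc Kd) m).

(** The product of the two triples has codomain [x], and [c] takes the same value on the first two
    components of any triple. *)
Lemma span_op_c {Z : C} (x y z : Hom Z D) (Hd : d ∘ x = d ∘ y)
    (Hc : c ∘ y = c ∘ z) : c ∘ span_op M x y z Hd Hc = c ∘ x.
Proof.
  unfold span_op. rewrite comp_assoc, <- span_comm12, <- comp_assoc. f_equal.
  etransitivity; [apply (@mul_c C L (umg L _ m M)) | apply span1_mk].
Qed.

Lemma span_op_d {Z : C} (x y z : Hom Z D) (Hd : d ∘ x = d ∘ y)
    (Hc : c ∘ y = c ∘ z) : d ∘ span_op M x y z Hd Hc = d ∘ z.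
Proof.
  unfold span_op. rewrite comp_assoc, span_comm23, <- comp_assoc. f_equal.
  etransitivity; [apply (@mul_d C L (umg L _ m M)) | apply span3_mk].
Qed.

(** For [y = z] the right factor [(y, z, z)] is an identity of [span_graph]. *)
Lemma span_op_left {Z : C} (x y z : Hom Z D) (Hd : d ∘ x = d ∘ y)
    (Hc : c ∘ y = c ∘ z) : y = z -> span_op M x y z Hd Hc = x.
Proof.
  intros ->. unfold span_op. rewrite mul_unit_r; [apply span2_mk |]; simpl.
  rewrite span3_mk. symmetry. apply span_mk_comp; apply comp_idl.
Qed.

Lemma span_op_right {Z : C} (x y z : Hom Z D) (Hd : d ∘ x = d ∘ y)
    (Hc : c ∘ y = c ∘ z) : x = y -> span_op M x y z Hd Hc = z.
Proof.
  intros ->. unfold span_op. rewrite mul_unit_l; [apply span2_mk |]; simpl.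
  rewrite span1_mk. symmetry. apply span_mk_comp; apply comp_idl.
Qed.

Lemma span_op_comp {Z W : C} (x y z : Hom Z D) (Hd : d ∘ x = d ∘ y)
    (Hc : c ∘ y = c ∘ z) (u : Hom W Z)
    (Hd' : d ∘ (x ∘ u) = d ∘ (y ∘ u)) (Hc' : c ∘ (y ∘ u) = c ∘ (z ∘ u)) :
  span_op M x y z Hd Hc ∘ u = span_op M (x ∘ u) (y ∘ u) (z ∘ u) Hd' Hc'.
Proof.
  unfold span_op. rewrite <- comp_assoc. f_equal.
  apply (mul_comp (umg L _ m M)); now apply span_mk_comp.
Qed.

End SpanOp.

(** A morphism [f] compatible with [c], [c'] and [d], [d'] through [k] and [l] induces a graph
    morphism between the graphs of triples, and the multiplication is natural along it. The two
    graphs may have unrelated bases, as needed to pass from [E] to [D]. *)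
Lemma span_op_map {C : Category} {L : LocalProducts C}
    (m : forall X : RGraph C, Hom (rg2 L X) (rg1 X))
    (M : forall X : RGraph C, IsMult L X (m X))
    (N : forall (X Y : RGraph C) (f : RGHom X Y) (Z : C) (x y : Hom Z (rg1 X))
      (H : rg_d X ∘ x = rg_c X ∘ y)
      (H' : rg_d Y ∘ (rgh1 f ∘ x) = rg_c Y ∘ (rgh1 f ∘ y)),
      rgh1 f ∘ mul (umg L X (m X) (M X)) x y H =
      mul (umg L Y (m Y) (M Y)) (rgh1 f ∘ x) (rgh1 f ∘ y) H')
    {D D0 D1 D' D0' D1' : C} {d : Hom D D0} {c : Hom D D1}
    (Kc : Pullback c c) (Kd : Pullback d d) {d' : Hom D' D0'} {c' : Hom D' D1'}
    (Kc' : Pullback c' c') (Kd' : Pullback d' d')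
    (f : Hom D D') (k : Hom D1 D1') (l : Hom D0 D0')
    (Hk : c' ∘ f = k ∘ c) (Hl : d' ∘ f = l ∘ d) {Z : C} (x y z : Hom Z D)
    (Hd : d ∘ x = d ∘ y) (Hc : c ∘ y = c ∘ z) (x' y' z' : Hom Z D')
    (Hd' : d' ∘ x' = d' ∘ y') (Hc' : c' ∘ y' = c' ∘ z') :
  f ∘ x = x' -> f ∘ y = y' -> f ∘ z = z' ->
  f ∘ span_op (M (span_graph L Kc Kd)) x y z Hd Hc =
  span_op (M (span_graph L Kc' Kd')) x' y' z' Hd' Hc'.
Proof.
  intros <- <- <-. unfold span_op.
  set (F := span_map L Kc Kd Kc' Kd' f k l Hk Hl).
  assert (F2 : span2 L Kc' Kd' ∘ rgh1 F = f ∘ span2 L Kc Kd) by apply span2_mk.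
  rewrite comp_assoc, <- F2, <- comp_assoc. f_equal.
  unshelve refine (eq_trans (N _ _ F _ _ _ _ _) _).
  - now rewrite !comp_assoc, rgh_d, rgh_c, <- !comp_assoc; simpl;
      rewrite span1_mk, span3_mk.
  - apply (mul_eq (umg L (span_graph L Kc' Kd') _ (M _)));
      apply span_mk_comp; rewrite <- comp_assoc;
      now rewrite ?span1_mk, ?span2_mk, ?span3_mk.
Qed.

(** * From a section to the Kite Condition *)

Lemma section_kite {C : Category} (L : LocalProducts C) :
  HasSection (forgetCat L) -> KiteCondition C.
Proof.
  intros HS. destruct (section_mul L HS) as [m [M N]]. clear HS.
  intros A B E D D0 D1 p1 e1 p2 e2 alpha beta gamma d c
    H11 H22 Hcomm Hmono Hab Hbg Hd Hc [Kd] [Kc].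
  assert (Xd : d ∘ (alpha ∘ p1) = d ∘ beta).
  { rewrite comp_assoc, Hd, <- Hab, <- !comp_assoc. reflexivity. }
  assert (Xc : c ∘ beta = c ∘ (gamma ∘ p2)).
  { symmetry. rewrite comp_assoc, Hc, Hbg, <- !comp_assoc. reflexivity. }
  exists (span_op (M (span_graph L Kc Kd)) (alpha ∘ p1) beta (gamma ∘ p2) Xd Xc).
  split.
  - split; [| split; [| split]].
    (* Along [e1] the last two entries [beta] and [gamma ∘ p2] agree; along [e2] the first two
       do. *)
    + unshelve erewrite span_op_comp.
      1, 2: now apply comp_square.
      rewrite span_op_left.
      * now rewrite <- comp_assoc, H11, comp_idr.
      * rewrite Hbg, <- !comp_assoc, H11. now rewrite comp_idr.
    + unshelve erewrite span_op_comp.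
      1, 2: now apply comp_square.
      rewrite span_op_right.
      * now rewrite <- comp_assoc, H22, comp_idr.
      * rewrite <- Hab, <- !comp_assoc, H22. now rewrite comp_idr.
    + rewrite span_op_d. apply comp_assoc.
    + rewrite span_op_c. apply comp_assoc.
  - intros n [Hn1 [Hn2 [Hnd Hnc]]].
    (* On [E], [p1] takes the role of [c] and [p2] that of [d]. The equations on [n] make it
       compatible with these through [c ∘ alpha] and [d ∘ gamma]. *)
    destruct (split_kernel_pair L _ _ H11) as [K1],
      (split_kernel_pair L _ _ H22) as [K2].
    assert (Yd : p2 ∘ (e1 ∘ p1) = p2 ∘ (e1 ∘ p1 ∘ (e2 ∘ p2))).
    { now rewrite Hcomm, <- !comp_assoc, (comp_whisker H22), comp_idl. }
    assert (Yc : p1 ∘ (e1 ∘ p1 ∘ (e2 ∘ p2)) = p1 ∘ (e2 ∘ p2)).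
    { now rewrite <- !comp_assoc, (comp_whisker H11), comp_idl. }
    transitivity (n ∘ span_op (M (span_graph L K1 K2)) _ _ _ Yd Yc).
    + symmetry. rewrite <- comp_assoc in Hnd, Hnc.
      apply (span_op_map m M N K1 K2 Kc Kd n (c ∘ alpha) (d ∘ gamma)).
      * now rewrite Hnc, comp_assoc.
      * now rewrite Hnd, comp_assoc.
      * now rewrite comp_assoc, Hn1.
      * now rewrite <- Hab, !comp_assoc, Hn1.
      * now rewrite comp_assoc, Hn2.
    + rewrite <- (comp_idr n) at 2. f_equal. apply Hmono; rewrite comp_idr.
      * now rewrite span_op_c, comp_assoc, H11, comp_idl.
      * now rewrite span_op_d, comp_assoc, H22, comp_idl.
Qed.

(** * Unique, natural and associative multiplications from the Kite Condition *)

(** This is the kite on the object of composable pairs with [alpha] and [gamma] identities; [rg_e]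
    splits [d] and [c], which gives their kernel pairs. *)
Lemma kite_mult {C : Category} (K : KiteCondition C) (L : LocalProducts C)
    (X : RGraph C) : exists! m : Hom (rg2 L X) (rg1 X), IsMult L X m.
Proof.
  destruct (kite_lp K L _ _ _ _ (rg_de X) (rg_ce X) (idm (rg1 X))
    (idm (rg1 X)) (rg_d X) (rg_c X) eq_refl) as [m [[H1 [H2 [H3 H4]]] U]].
  - now rewrite comp_idr, rg_de, comp_idl.
  - now rewrite comp_idr, rg_ce, comp_idl.
  - exact (split_kernel_pair L _ _ (rg_de X)).
  - exact (split_kernel_pair L _ _ (rg_ce X)).
  - rewrite comp_idr in H3, H4. exists m; split; [now repeat split |].
    intros n [N1 [N2 [N3 N4]]]. apply U. rewrite !comp_idr. now repeat split.
Qed.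

Lemma umg_inj {C : Category} (K : KiteCondition C) {L : LocalProducts C}
    (X Y : UMGraph L) : um_rg X = um_rg Y -> X = Y.
Proof.
  pose proof (um_is_mult X) as HX. pose proof (um_is_mult Y) as HY.
  destruct X as [G m], Y as [G' m']; simpl in *. intros <-.
  destruct (exists_unique_eq m m' (kite_mult K L G) HX HY).
  f_equal; apply proof_irrelevance.
Qed.

Lemma rgh2_fst {C : Category} (L : LocalProducts C) {X Y : RGraph C}
    (f : RGHom X Y) :
  pb_fst (rg2 L Y) ∘ rgh2 L f = rgh1 f ∘ pb_fst (rg2 L X).
Proof. apply pb_fst_pair. Qed.

Lemma rgh2_snd {C : Category} (L : LocalProducts C) {X Y : RGraph C}
    (f : RGHom X Y) :
  pb_snd (rg2 L Y) ∘ rgh2 L f = rgh1 f ∘ pb_snd (rg2 L X).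
Proof. apply pb_snd_pair. Qed.

Lemma rgh2_e1 {C : Category} (L : LocalProducts C) {X Y : RGraph C}
    (f : RGHom X Y) : rgh2 L f ∘ rg_e1 L X = rg_e1 L Y ∘ rgh1 f.
Proof.
  unfold rg_e1, lp_e1. apply pb_unique;
    rewrite !comp_assoc, ?rgh2_fst, ?rgh2_snd, ?pb_fst_pair, ?pb_snd_pair.
  - rewrite <- comp_assoc. etransitivity; [apply f_equal, pb_fst_pair |].
    now rewrite comp_idl, comp_idr.
  - rewrite <- comp_assoc. etransitivity; [apply f_equal, pb_snd_pair |].
    now rewrite comp_assoc, rgh_e, <- !comp_assoc, rgh_d.
Qed.

Lemma rgh2_e2 {C : Category} (L : LocalProducts C) {X Y : RGraph C}
    (f : RGHom X Y) : rgh2 L f ∘ rg_e2 L X = rg_e2 L Y ∘ rgh1 f.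
Proof.
  unfold rg_e2, lp_e2. apply pb_unique;
    rewrite !comp_assoc, ?rgh2_fst, ?rgh2_snd, ?pb_fst_pair, ?pb_snd_pair.
  - rewrite <- comp_assoc. etransitivity; [apply f_equal, pb_fst_pair |].
    now rewrite comp_assoc, rgh_e, <- !comp_assoc, rgh_c.
  - rewrite <- comp_assoc. etransitivity; [apply f_equal, pb_snd_pair |].
    now rewrite comp_idl, comp_idr.
Qed.

(** Both sides solve the kite on composable pairs of [X] with [alpha] and [gamma] equal to
    [rgh1 f]. *)
Lemma kite_umhom {C : Category} (K : KiteCondition C) {L : LocalProducts C}
    (X Y : UMGraph L) (f : RGHom X Y) :
  rgh1 f ∘ um_m X = um_m Y ∘ rgh2 L f.
Proof.
  refine (exists_unique_eq _ _
    (kite_lp K L _ _ _ _ (rg_de X) (rg_ce X) (rgh1 f) (rgh1 f)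
      (rg_d Y) (rg_c Y) eq_refl _ _ (split_kernel_pair L _ _ (rg_de Y))
      (split_kernel_pair L _ _ (rg_ce Y))) _ _).
  - now rewrite rgh_d, <- comp_assoc, <- comp_assoc, (comp_whisker (rg_de X)),
      comp_idl.
  - now rewrite rgh_c, <- comp_assoc, <- comp_assoc, (comp_whisker (rg_ce X)),
      comp_idl.
  - fold (rg2 L X) (rg_e1 L X) (rg_e2 L X). repeat split.
    + now rewrite <- comp_assoc, um_me1, comp_idr.
    + now rewrite <- comp_assoc, um_me2, comp_idr.
    + now rewrite comp_assoc, rgh_d, <- !comp_assoc, um_dm.
    + now rewrite comp_assoc, rgh_c, <- !comp_assoc, um_cm.
  - fold (rg2 L X) (rg_e1 L X) (rg_e2 L X). repeat split.
    + now rewrite <- comp_assoc, rgh2_e1, comp_assoc, um_me1, comp_idl.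
    + now rewrite <- comp_assoc, rgh2_e2, comp_assoc, um_me2, comp_idl.
    + now rewrite comp_assoc, um_dm, <- !comp_assoc, rgh2_snd.
    + now rewrite comp_assoc, um_cm, <- !comp_assoc, rgh2_fst.
Qed.

(** The generic composable triple lives on a local product of composable pairs with arrows. There
    both bracketings solve the kite with [alpha] the multiplication and [gamma] the identity; the
    general case follows by precomposition. *)
Lemma kite_assoc {C : Category} (K : KiteCondition C) {L : LocalProducts C}
    (X : UMGraph L) : Associative X.
Proof.
  intros Z x y z Hxy Hyz.
  (* A composable pair is sent to its domain; the splitting [r] sends an object to the pair of its
     identities. Hence [P3] is a local product. *)
  set (f := rg_d X ∘ pb_snd (rg2 L X) : Hom (rg2 L X) (rg0 X)).
  set (r := rg_e1 L X ∘ rg_e X).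
  assert (fst1 : pb_fst (rg2 L X) ∘ rg_e1 L X = idm _) by apply pb_fst_pair.
  assert (snd1 : pb_snd (rg2 L X) ∘ rg_e1 L X = rg_e X ∘ rg_d X)
    by apply pb_snd_pair.
  assert (Hr1 : pb_fst (rg2 L X) ∘ r = rg_e X).
  { unfold r. now rewrite comp_assoc, fst1, comp_idl. }
  assert (Hr2 : pb_snd (rg2 L X) ∘ r = rg_e X).
  { unfold r. now rewrite comp_assoc, snd1, <- comp_assoc, rg_de, comp_idr. }
  assert (Hf : f ∘ r = idm (rg0 X)).
  { unfold f. now rewrite <- comp_assoc, Hr2, rg_de. }
  assert (Hmr : um_m X ∘ r = rg_e X).
  { unfold r. now rewrite comp_assoc, um_me1, comp_idl. }
  set (P3 := L _ _ _ f r (rg_c X) (rg_e X) Hf (rg_ce X)).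
  set (u := pb_fst (rg2 L X) ∘ pb_fst P3).
  set (v := pb_snd (rg2 L X) ∘ pb_fst P3).
  set (w := pb_snd P3).
  assert (Huv : rg_d X ∘ u = rg_c X ∘ v).
  { unfold u, v. now rewrite !comp_assoc, pb_comm. }
  assert (Hvw : rg_d X ∘ v = rg_c X ∘ w).
  { unfold v, w. rewrite comp_assoc. apply (pb_comm P3). }
  assert (Huv1 : mul X u v Huv = um_m X ∘ pb_fst P3).
  { rewrite <- mul_projections. symmetry. now apply mul_comp. }
  (* Along [q1] the third factor [w] is an identity; along [q2] the factors [u] and [v] are. *)
  set (q1 := lp_e1 L Hf (rg_ce X) : Hom (rg2 L X) P3).
  set (q2 := lp_e2 L Hf (rg_ce X) : Hom (rg1 X) P3).
  assert (E1 : pb_fst P3 ∘ q1 = idm _) by apply pb_fst_pair.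
  assert (E2 : w ∘ q1 = rg_e X ∘ f) by apply pb_snd_pair.
  assert (E3 : pb_fst P3 ∘ q2 = r ∘ rg_c X) by apply pb_fst_pair.
  assert (E4 : w ∘ q2 = idm _) by apply pb_snd_pair.
  assert (U1 : u ∘ q1 = pb_fst (rg2 L X)).
  { unfold u. now rewrite <- comp_assoc, E1, comp_idr. }
  assert (V1 : v ∘ q1 = pb_snd (rg2 L X)).
  { unfold v. now rewrite <- comp_assoc, E1, comp_idr. }
  assert (U2 : u ∘ q2 = rg_e X ∘ rg_c X).
  { unfold u. now rewrite <- comp_assoc, E3, comp_assoc, Hr1. }
  assert (V2 : v ∘ q2 = rg_e X ∘ rg_c X).
  { unfold v. now rewrite <- comp_assoc, E3, comp_assoc, Hr2. }
  assert (Main : mul X (mul X u v Huv) w (eq_trans (mul_d Huv) Hvw) =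
    mul X u (mul X v w Hvw) (eq_trans Huv (eq_sym (mul_c Hvw)))).
  { refine (exists_unique_eq _ _
      (kite_lp K L _ _ _ _ Hf (rg_ce X) (um_m X) (idm _) (rg_d X) (rg_c X)
        _ _ _ (split_kernel_pair L _ _ (rg_de X))
        (split_kernel_pair L _ _ (rg_ce X))) _ _).
    - now rewrite Hmr, comp_idl.
    - rewrite <- (comp_assoc (rg_d X)), Hmr, rg_de, comp_idl. apply um_dm.
    - now rewrite comp_idr, rg_ce, comp_idl.
    - fold P3 q1 q2 w. split; [| split; [| split]].
      + unshelve erewrite (mul_comp X _ _ _ q1 _ _ _ eq_refl eq_refl);
          [now apply comp_square; rewrite mul_d |].
        rewrite mul_unit_r.
        * rewrite Huv1, <- comp_assoc, E1. apply comp_idr.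
        * now rewrite E2, (comp_assoc (rg_d X)), mul_d, <- comp_assoc, V1.
      + unshelve erewrite (mul_comp X _ _ _ q2 _ _ _ eq_refl eq_refl);
          [now apply comp_square; rewrite mul_d |].
        rewrite mul_unit_l; [apply E4 |].
        now rewrite Huv1, <- comp_assoc, E3, comp_assoc, Hmr, E4, comp_idr.
      + now rewrite (mul_d (eq_trans (mul_d Huv) Hvw)), comp_idr.
      + now rewrite (mul_c (eq_trans (mul_d Huv) Hvw)), Huv1, comp_assoc.
    - fold P3 q1 q2 w. split; [| split; [| split]].
      + unshelve erewrite (mul_comp X _ _ _ q1 _ _ _ eq_refl eq_refl);
          [now apply comp_square; rewrite mul_c |].
        rewrite <- mul_projections. apply mul_eq; [exact U1 |].
        unshelve erewrite (mul_comp X _ _ _ q1 _ _ _ eq_refl eq_refl);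
          [now apply comp_square |].
        rewrite mul_unit_r; [exact V1 |]. now rewrite E2, V1.
      + unshelve erewrite (mul_comp X _ _ _ q2 _ _ _ eq_refl eq_refl);
          [now apply comp_square; rewrite mul_c |].
        assert (VW2 : mul X v w Hvw ∘ q2 = idm _).
        { unshelve erewrite (mul_comp X _ _ _ q2 _ _ _ eq_refl eq_refl);
            [now apply comp_square |].
          rewrite mul_unit_l; [exact E4 |]. now rewrite V2, E4, comp_idr. }
        rewrite mul_unit_l; [exact VW2 |]. now rewrite U2, VW2, comp_idr.
      + now rewrite (mul_d (eq_trans Huv (eq_sym (mul_c Hvw)))), (mul_d Hvw),
          comp_idr.
      + rewrite (mul_c (eq_trans Huv (eq_sym (mul_c Hvw)))). unfold u.
        now rewrite um_cm, comp_assoc. }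
  assert (Ht : f ∘ pb_pair (rg2 L X) x y Hxy = rg_c X ∘ z).
  { unfold f. now rewrite <- comp_assoc, pb_snd_pair. }
  (* [t] classifies the given triple, so precomposing the generic equation with it gives the
     claim. *)
  set (t := pb_pair P3 _ _ Ht).
  assert (Tu : u ∘ t = x).
  { unfold u, t. now rewrite <- comp_assoc, !pb_fst_pair. }
  assert (Tv : v ∘ t = y).
  { unfold v, t. now rewrite <- comp_assoc, pb_fst_pair, pb_snd_pair. }
  assert (Tw : w ∘ t = z) by apply pb_snd_pair.
  apply (f_equal (fun k => k ∘ t)) in Main.
  etransitivity; [symmetry | etransitivity; [exact Main |]];
    apply mul_comp; try assumption; now apply mul_comp.
Qed.

(** * Inverses from the Kite Condition *)

(** The kite on the object of triples, with [alpha] and [gamma] the outer projections, gives a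
    generic [m]; its value at [(x, y, z)] is [w]. *)
Lemma kite_malcev {C : Category} (K : KiteCondition C) (L : LocalProducts C)
    {D D0 D1 Z : C} (d : Hom D D0) (c : Hom D D1) (x y z : Hom Z D) :
  HasKernelPair d -> HasKernelPair c ->
  d ∘ x = d ∘ y -> c ∘ y = c ∘ z ->
  exists w : Hom Z D, c ∘ w = c ∘ x /\ d ∘ w = d ∘ z.
Proof.
  intros [Kd] [Kc] Hd Hc.
  destruct (kite_lp K L _ _ _ _ (kp_snd_diag Kd) (kp_fst_diag Kc)
    (pb_fst Kd) (pb_snd Kc) d c) as [m [[_ [_ [Md Mc]]] _]].
  - now rewrite kp_fst_diag, kp_snd_diag.
  - rewrite <- (comp_assoc d), kp_fst_diag, comp_idr. apply pb_comm.
  - rewrite <- (comp_assoc c), kp_snd_diag, comp_idr. symmetry. apply pb_comm.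
  - exact (inhabits Kd).
  - exact (inhabits Kc).
  (* Here [d] relates the first two entries and [c] the last two, so [c] and [d] are exchanged in
     [span]. *)
  - fold (span L Kd Kc) in m, Md, Mc.
    exists (m ∘ span_mk L Kd Kc x y z Hd Hc). split.
    + rewrite comp_assoc, Mc, <- (comp_assoc c), <- (comp_assoc c). f_equal.
      apply span1_mk.
    + rewrite comp_assoc, Md, <- (comp_assoc d), <- (comp_assoc d). f_equal.
      apply span3_mk.
Qed.

(** The monoid argument [j = j (x i) = (j x) i = i]. *)
Lemma mul_inverses_eq {C : Category} {L : LocalProducts C} (X : UMGraph L)
    (HA : Associative X) {Z : C} (j x i : Hom Z (rg1 X))
    (Hjx : rg_d X ∘ j = rg_c X ∘ x) (Hxi : rg_d X ∘ x = rg_c X ∘ i) :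
  mul X j x Hjx = rg_e X ∘ (rg_d X ∘ x) ->
  mul X x i Hxi = rg_e X ∘ (rg_c X ∘ x) -> j = i.
Proof.
  intros Hj Hi.
  rewrite <- (mul_unit_r X j (mul X x i Hxi) (eq_trans Hjx (eq_sym (mul_c Hxi)))).
  - rewrite <- HA. apply mul_unit_l. now rewrite Hj, Hxi.
  - now rewrite Hi, Hjx.
Qed.

Lemma kite_inverses {C : Category} (K : KiteCondition C) {L : LocalProducts C}
    (X : UMGraph L) : HasInverses X.
Proof.
  assert (F1 : pb_fst (rg2 L X) ∘ rg_e1 L X = idm _) by apply pb_fst_pair.
  assert (S1 : pb_snd (rg2 L X) ∘ rg_e1 L X = rg_e X ∘ rg_d X)
    by apply pb_snd_pair.
  assert (F2 : pb_fst (rg2 L X) ∘ rg_e2 L X = rg_e X ∘ rg_c X)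
    by apply pb_fst_pair.
  assert (S2 : pb_snd (rg2 L X) ∘ rg_e2 L X = idm _) by apply pb_snd_pair.
  (* The multiplication is itself split by [rg_e1], so it can serve as [d] in [kite_malcev]. *)
  pose proof (split_kernel_pair L _ _ (um_me1 X)) as Km.
  (* Composable pairs with first component [x], resp. second component [x],
     and with identity composite. *)
  destruct (kite_malcev K L (um_m X) (pb_fst (rg2 L X)) (rg_e1 L X) (rg_e2 L X)
    (rg_e1 L X ∘ (rg_e X ∘ rg_c X)) Km (split_kernel_pair L _ _ F1))
    as [w [Wf Wm]].
  { now rewrite um_me1, um_me2. }
  { now rewrite F2, comp_assoc, F1, comp_idl. }
  destruct (kite_malcev K L (um_m X) (pb_snd (rg2 L X)) (rg_e2 L X) (rg_e1 L X)
    (rg_e2 L X ∘ (rg_e X ∘ rg_d X)) Km (split_kernel_pair L _ _ S2))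
    as [v [Vs Vm]].
  { now rewrite um_me1, um_me2. }
  { now rewrite S1, comp_assoc, S2, comp_idl. }
  rewrite F1 in Wf. rewrite comp_assoc, um_me1, comp_idl in Wm.
  rewrite S2 in Vs. rewrite comp_assoc, um_me2, comp_idl in Vm.
  (* [w] is the pair [(1, i)] and [v] the pair [(j, 1)]: right and left inverses of the generic
     arrow, which associativity identifies. *)
  set (i := pb_snd (rg2 L X) ∘ w). set (j := pb_fst (rg2 L X) ∘ v).
  assert (Hxi : rg_d X ∘ idm _ = rg_c X ∘ i).
  { unfold i. now rewrite comp_assoc, <- pb_comm, <- comp_assoc, Wf. }
  assert (Hjx : rg_d X ∘ j = rg_c X ∘ idm _).
  { unfold j. now rewrite comp_assoc, pb_comm, <- comp_assoc, Vs. }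
  assert (Mi : mul X (idm _) i Hxi = rg_e X ∘ rg_c X).
  { rewrite <- Wm, <- mul_projections. symmetry. now apply mul_comp. }
  assert (Mj : mul X j (idm _) Hjx = rg_e X ∘ rg_d X).
  { rewrite <- Vm, <- mul_projections. symmetry. now apply mul_comp. }
  assert (Hji : j = i).
  { apply (mul_inverses_eq X (kite_assoc K X) j (idm _) i Hjx Hxi);
      now rewrite comp_idr. }
  clearbody i j. subst j.
  exists i, (eq_trans Hjx (comp_idr _)),
    (eq_sym (eq_trans (eq_sym (comp_idr _)) Hxi)).
  split; [rewrite <- Mi | rewrite <- Mj]; now apply mul_eq.
Qed.

(** * The functors inverse to the forgetful functors *)

(** A functor needs the multiplication as data, whereas [kite_mult] only asserts its existence;
    hence the use of description. *)
Definition kite_umg {C : Category} (K : KiteCondition C) (L : LocalProducts C)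
    (X : RGraph C) : UMGraph L :=
  let m := constructive_indefinite_description _ (kite_mult K L X) in
  umg L X (proj1_sig m) (proj1 (proj2_sig m)).

Definition kite_umg_map {C : Category} (K : KiteCondition C)
    (L : LocalProducts C) {X Y : RGraph C} (f : RGHom X Y) :
    UMHom (kite_umg K L X) (kite_umg K L Y) :=
  @Build_UMHom C L (kite_umg K L X) (kite_umg K L Y) f
    (kite_umhom K (kite_umg K L X) (kite_umg K L Y) f).

Definition kite_cat {C : Category} (K : KiteCondition C) (L : LocalProducts C) :
    Functor (RG C) (Cat L).
Proof.
  refine {| fobj := fun X : RG C =>
              exist (@Associative C L) (kite_umg K L X) (kite_assoc K _) : Cat L;
            fmap := fun X Y f => kite_umg_map K L f |};
    intros; now apply UMHom_eq.
Defined.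

Definition kite_grpd {C : Category} (K : KiteCondition C) (L : LocalProducts C) :
    Functor (RG C) (Grpd L).
Proof.
  refine {| fobj := fun X : RG C =>
              exist (fun Y : Cat L => HasInverses (proj1_sig Y)) (kite_cat K L X)
                (kite_inverses K _) : Grpd L;
            fmap := fun X Y f => kite_umg_map K L f |};
    intros; now apply UMHom_eq.
Defined.

Lemma sig_eq {T : Type} {Q : T -> Prop} (x y : {t : T | Q t}) :
  proj1_sig x = proj1_sig y -> x = y.
Proof.
  destruct x, y; simpl. intros <-. f_equal. apply proof_irrelevance.
Qed.

(** Injectivity on objects is the uniqueness of multiplications, and faithfulness holds because
    preservation of the multiplication is a property of a graph morphism. *)
Lemma kite_cat_iso {C : Category} (K : KiteCondition C) (L : LocalProducts C) :
  IsoOfCategories (forgetCat L).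
Proof.
  apply (section_iso _ (kite_cat K L)).
  - intros A B H. apply sig_eq. now apply (umg_inj K).
  - intros A B f g. apply UMHom_eq.
  - now apply functor_ext.
Qed.

Lemma kite_grpd_iso {C : Category} (K : KiteCondition C) (L : LocalProducts C) :
  IsoOfCategories (forgetGrpd L).
Proof.
  apply (section_iso _ (kite_grpd K L)).
  - intros A B H. do 2 apply sig_eq. now apply (umg_inj K).
  - intros A B f g. apply UMHom_eq.
  - now apply functor_ext.
Qed.

Lemma grpd_section_cat {C : Category} (L : LocalProducts C) :
  HasSection (forgetGrpd L) -> HasSection (forgetCat L).
Proof.
  intros [S H].
  exists (compF (inclusion (fun X : Cat L => HasInverses (proj1_sig X))) S).
  rewrite <- H. now apply functor_ext.
Qed.

(** * Natural Mal'tsev operations in the presence of finite products *)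

Lemma terminal_kernel_pair {C : Category} (P : BinaryProducts C)
    (T : TerminalObject C) (D : C) : HasKernelPair (term_arrow T D).
Proof.
  constructor.
  exact {| pb_obj := bprod P D D;
           pb_fst := bprod_fst P D D;
           pb_snd := bprod_snd P D D;
           pb_comm := term_unique _ _;
           pb_pair := fun Z x y _ => bprod_pair P x y;
           pb_fst_pair := fun Z x y _ => bprod_fst_pair P x y;
           pb_snd_pair := fun Z x y _ => bprod_snd_pair P x y;
           pb_unique := @bprod_unique C P D D |}.
Qed.

Lemma triple_comp {C : Category} (P : BinaryProducts C) {D Z W : C}
    (x y z : Hom Z D) (u : Hom W Z) :
  triple P x y z ∘ u = triple P (x ∘ u) (y ∘ u) (z ∘ u).
Proof.
  apply cube_ext; rewrite comp_assoc, ?cube_1_triple, ?cube_2_triple,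
    ?cube_3_triple; reflexivity.
Qed.

(** The kite on the cube: [p1] and [p2] keep the first and the last two coordinates, [e1] and [e2]
    repeat the last and the first one, and [d] and [c] go to the terminal object. The case of an
    identity [f] defines the operation; general [f] gives its naturality. *)
Lemma kite_cube {C : Category} (K : KiteCondition C) (P : BinaryProducts C)
    (T : TerminalObject C) (D D' : C) (f : Hom D D') :
  exists! m : Hom (cube_obj P D) D',
    m ∘ triple P (bprod_fst P D D) (bprod_snd P D D) (bprod_snd P D D) =
      f ∘ bprod_fst P D D /\
    m ∘ triple P (bprod_fst P D D) (bprod_fst P D D) (bprod_snd P D D) =
      f ∘ bprod_snd P D D.
Proof.
  set (p1 := bprod_pair P (cube_1 P D) (cube_2 P D)).
  set (p2 := bprod_pair P (cube_2 P D) (cube_3 P D)).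
  set (e1 := triple P (bprod_fst P D D) (bprod_snd P D D) (bprod_snd P D D)).
  set (e2 := triple P (bprod_fst P D D) (bprod_fst P D D) (bprod_snd P D D)).
  assert (F1 : bprod_fst P D D ∘ p1 = cube_1 P D) by apply bprod_fst_pair.
  assert (S1 : bprod_snd P D D ∘ p1 = cube_2 P D) by apply bprod_snd_pair.
  assert (F2 : bprod_fst P D D ∘ p2 = cube_2 P D) by apply bprod_fst_pair.
  assert (S2 : bprod_snd P D D ∘ p2 = cube_3 P D) by apply bprod_snd_pair.
  assert (E1 : e1 ∘ p1 = triple P (cube_1 P D) (cube_2 P D) (cube_2 P D)).
  { unfold e1. now rewrite triple_comp, F1, S1. }
  assert (E2 : e2 ∘ p2 = triple P (cube_2 P D) (cube_2 P D) (cube_3 P D)).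
  { unfold e2. now rewrite triple_comp, F2, S2. }
  assert (B1 : f ∘ bprod_fst P D D ∘ p1 ∘ e2 ∘ p2 = f ∘ cube_2 P D).
  { rewrite <- !comp_assoc, E2, (comp_whisker F1). now rewrite cube_1_triple. }
  assert (B2 : f ∘ bprod_snd P D D ∘ p2 ∘ e1 ∘ p1 = f ∘ cube_2 P D).
  { rewrite <- !comp_assoc, E1, (comp_whisker S2). now rewrite cube_3_triple. }
  destruct (K _ _ _ _ _ _ p1 e1 p2 e2 (f ∘ bprod_fst P D D) (f ∘ cube_2 P D)
    (f ∘ bprod_snd P D D) (term_arrow T D') (term_arrow T D'))
    as [m [[M1 [M2 _]] U]].
  - apply bprod_unique; rewrite comp_assoc, comp_idr.
    + now rewrite F1; apply cube_1_triple.
    + now rewrite S1; apply cube_2_triple.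
  - apply bprod_unique; rewrite comp_assoc, comp_idr.
    + now rewrite F2; apply cube_2_triple.
    + now rewrite S2; apply cube_3_triple.
  - rewrite E1, E2, !triple_comp.
    now rewrite !cube_1_triple, !cube_2_triple, !cube_3_triple.
  - intros Z u v H1 H2.
    apply cube_ext.
    + now rewrite <- F1, <- !comp_assoc, H1.
    + now rewrite <- F2, <- !comp_assoc, H2.
    + now rewrite <- S2, <- !comp_assoc, H2.
  - exact B1.
  - now rewrite B2.
  - apply term_unique.
  - apply term_unique.
  - now apply terminal_kernel_pair.
  - now apply terminal_kernel_pair.
  - exists m. split; [now split |]. intros n [N1 N2]. apply U.
    repeat split; try assumption; apply term_unique.
Qed.

Lemma kite_natural_malcev {C : Category} (K : KiteCondition C)
    (P : BinaryProducts C) (T : TerminalObject C) :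
  exists p : NatTrans (Cube P) (idF C),
    forall (D Z : C) (x y : Hom Z D),
      p D ∘ triple P x y y = x /\ p D ∘ triple P x x y = y.
Proof.
  set (p := fun D => constructive_indefinite_description _
    (kite_cube K P T D D (idm D))).
  assert (Hp1 : forall D Z (x y : Hom Z D),
    proj1_sig (p D) ∘ triple P x y y = x).
  { intros D Z x y. destruct (p D) as [m [[M1 M2] U]]; simpl. clear p U.
    (* The equation for the generic pair is evaluated at [⟨x, y⟩]. *)
    apply (f_equal (fun k => k ∘ bprod_pair P x y)) in M1.
    now rewrite <- comp_assoc, triple_comp, comp_idl, bprod_fst_pair,
      bprod_snd_pair in M1. }
  assert (Hp2 : forall D Z (x y : Hom Z D),
    proj1_sig (p D) ∘ triple P x x y = y).
  { intros D Z x y. destruct (p D) as [m [[M1 M2] U]]; simpl. clear p Hp1 U.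
    apply (f_equal (fun k => k ∘ bprod_pair P x y)) in M2.
    now rewrite <- comp_assoc, triple_comp, comp_idl, bprod_fst_pair,
      bprod_snd_pair in M2. }
  unshelve eexists {| component := fun D : C =>
    proj1_sig (p D) : Hom (Cube P D) (idF C D) |}.
  (* Both sides of the naturality square solve [kite_cube] for [f]. *)
  - intros A B f. simpl. apply (exists_unique_eq _ _ (kite_cube K P T A B f)).
    + now rewrite <- !comp_assoc, Hp1, Hp2.
    + unfold cube_map. rewrite <- !comp_assoc, !triple_comp, <- !comp_assoc,
        !cube_1_triple, !cube_2_triple, !cube_3_triple.
      now rewrite Hp1, Hp2.
  - intros D Z x y. split; [apply Hp1 | apply Hp2].
Qed.

Lemma natural_malcev_triple {C : Category} (P : BinaryProducts C)
    (p : NatTrans (Cube P) (idF C)) {D D' Z : C} (f : Hom D D')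
    (x y z : Hom Z D) :
  f ∘ (p D ∘ triple P x y z) = p D' ∘ triple P (f ∘ x) (f ∘ y) (f ∘ z).
Proof.
  pose proof (naturality p f) as H; simpl in H.
  rewrite comp_assoc. etransitivity; [apply (f_equal (fun k => k ∘ _) H) |].
  unfold cube_map. rewrite <- comp_assoc, triple_comp, <- !comp_assoc.
  now rewrite cube_1_triple, cube_2_triple, cube_3_triple.
Qed.

(** The argument of [section_kite] with an operation defined on all triples: [p] at
    [(alpha ∘ p1, beta, gamma ∘ p2)] is a solution, and any solution [n] equals it by naturality,
    since the identity of [E] is itself a value of [p]. *)
Lemma natural_malcev_kite {C : Category} (P : BinaryProducts C)
    (p : forall D : C, Hom (cube_obj P D) D) :
  (forall (D D' Z : C) (f : Hom D D') (x y z : Hom Z D),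
     f ∘ (p D ∘ triple P x y z) = p D' ∘ triple P (f ∘ x) (f ∘ y) (f ∘ z)) ->
  (forall (D Z : C) (x y : Hom Z D),
     p D ∘ triple P x y y = x /\ p D ∘ triple P x x y = y) ->
  KiteCondition C.
Proof.
  intros N Hp A B E D D0 D1 p1 e1 p2 e2 alpha beta gamma d c
    H11 H22 Hcomm Hmono Hab Hbg Hd Hc _ _.
  assert (Xd : d ∘ (alpha ∘ p1) = d ∘ beta).
  { rewrite comp_assoc, Hd, <- Hab, <- !comp_assoc. reflexivity. }
  assert (Xc : c ∘ beta = c ∘ (gamma ∘ p2)).
  { symmetry. rewrite comp_assoc, Hc, Hbg, <- !comp_assoc. reflexivity. }
  exists (p D ∘ triple P (alpha ∘ p1) beta (gamma ∘ p2)). split.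
  - split; [| split; [| split]].
    + assert (Hb : beta ∘ e1 = gamma ∘ p2 ∘ e1).
      { now rewrite Hbg, <- !comp_assoc, H11, comp_idr. }
      rewrite <- comp_assoc, triple_comp, Hb.
      rewrite (proj1 (Hp D _ _ _)). now rewrite <- comp_assoc, H11, comp_idr.
    + assert (Hb : beta ∘ e2 = alpha ∘ p1 ∘ e2).
      { now rewrite <- Hab, <- !comp_assoc, H22, comp_idr. }
      rewrite <- comp_assoc, triple_comp, Hb.
      rewrite (proj2 (Hp D _ _ _)). now rewrite <- comp_assoc, H22, comp_idr.
    + rewrite N, Xd, (proj2 (Hp D0 _ _ _)).
      apply comp_assoc.
    + rewrite N, Xc, (proj1 (Hp D1 _ _ _)).
      apply comp_assoc.
  - intros n [Hn1 [Hn2 _]].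
    assert (He : p E ∘ triple P (e1 ∘ p1) (e1 ∘ p1 ∘ (e2 ∘ p2)) (e2 ∘ p2)
      = idm E).
    (* After [p1] the last two entries agree and the value is [p1]; after [p2] the first two agree
       and the value is [p2]. *)
    { apply Hmono; rewrite comp_idr, N.
      - rewrite <- (comp_assoc e1), !(comp_assoc p1), H11, !comp_idl.
        rewrite <- !(comp_assoc p1). apply Hp.
      - rewrite Hcomm, <- (comp_assoc e2), !(comp_assoc p2), H22, !comp_idl.
        rewrite <- !(comp_assoc p2). apply Hp. }
    rewrite <- (comp_idr n), <- He, N.
    now rewrite !comp_assoc, Hn1, Hn2, Hab.
Qed.

(** * The equivalences assembled *)

Theorem theorem1 (C : Category) (L : LocalProducts C) :
  (IsoOfCategories (forgetGrpd L) <-> HasSection (forgetGrpd L)) /\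
  (HasSection (forgetGrpd L) <-> IsoOfCategories (forgetCat L)) /\
  (IsoOfCategories (forgetCat L) <-> HasSection (forgetCat L)) /\
  (HasSection (forgetCat L) <-> KiteCondition C) /\
  (forall (P : BinaryProducts C) (T : TerminalObject C),
     KiteCondition C <->
     exists p : NatTrans (Cube P) (idF C),
       forall (D Z : C) (x y : Hom Z D),
         p D ∘ triple P x y y = x /\ p D ∘ triple P x x y = y).
Proof.
  (* The implications run from an isomorphism to a section, from groupoids to categories for
     sections, from a section for categories to the Kite Condition, and from there back to both
     isomorphisms. *)
  pose proof (iso_section (forgetGrpd L)) as H1.
  pose proof (grpd_section_cat L) as H2.
  pose proof (section_kite L) as H3.
  pose proof (fun K : KiteCondition C => kite_grpd_iso K L) as H4.
  pose proof (fun K : KiteCondition C => kite_cat_iso K L) as H5.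
  pose proof (iso_section (forgetCat L)) as H6.
  split; [tauto |]. split; [tauto |]. split; [tauto |]. split; [tauto |].
  intros P T. split.
  - intros K. now apply kite_natural_malcev.
  - intros [p Hp]. exact (natural_malcev_kite P p (@natural_malcev_triple C P p) Hp).
Qed.
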